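(* Let $r$ be a non-negative integer, let $n\ge 1$, let $a=(a_1,\ldots,a_n)$ and $b=(b_1,\ldots,b_n)$ be two $n$-tuples of positive integers, and let $X$ be a non-empty subset of $\{r+1,\to\}$. The graph $\mathrm{G}(\mathcal{N}_r(a,b,X))$ is a tree with root $\{0,r+1,\to\}$. Moreover, the set of children of a vertex $S$ in $\mathrm{G}(\mathcal{N}_r(a,b,X))$ is $$\left\{ S\setminus\{m\} \mid m\in\mathrm{msg}(S),\; m>\mathrm{F}(S),\; \text{and}\; S\setminus\{m\}\in\mathcal{N}(a,b,X)\right\}.$$
   Context: $\mathbb{N}$ is the set of non-negative integers, $\{k,\to\}=\{m\in\mathbb{N}\mid m\ge k\}$ and $\{0,k,\to\}=\{0\}\cup\{k,\to\}$. A numerical semigroup is a submonoid $S$ of $(\mathbb{N},+)$ with $\mathbb{N}\setminus S$ finite; its Frobenius number $\mathrm{F}(S)$ is the maximum integer not belonging to $S$ (so $\mathrm{F}(\mathbb{N})=-1$). $\mathrm{msg}(S)$ denotes the (unique) minimal system of generators of $S$, i.e. $\mathrm{msg}(S)=(S\setminus\{0\})\setminus\big((S\setminus\{0\})+(S\setminus\{0\})\big)$. For $s\in\mathbb{N}$, $as+b=(a_1s+b_1,\ldots,a_ns+b_n)$. $\mathcal{N}(a,b,X)$ is the set of all numerical semigroups $S$ such that $X\subseteq S$ and $as+b\in S^n$ for all $s\in S\setminus\{0\}$, and $\mathcal{N}_r(a,b,X)=\{S\in\mathcal{N}(a,b,X)\mid S\subseteq\{0,r+1,\to\}\}$. A graph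 is a pair $(V,E)$ with $V$ a non-empty set (of vertices) and $E\subseteq\{(v,w)\in V\times V\mid v\neq w\}$ (edges). A path of length $k$ connecting vertices $x$ and $y$ is a sequence of different edges $(v_0,v_1),\ldots,(v_{k-1},v_k)$ with $v_0=x$ and $v_k=y$. A graph is a tree if there is a vertex $\rho$ (the root) such that for every other vertex $x$ there exists a unique path connecting $x$ and $\rho$. If $(x,y)$ is an edge of a tree, then $x$ is a child of $y$. The graph $\mathrm{G}(\mathcal{N}_r(a,b,X))$ has vertex set $\mathcal{N}_r(a,b,X)$, and $(S,S')\in\mathcal{N}_r(a,b,X)\times\mathcal{N}_r(a,b,X)$ is an edge if and only if $S'=S\cup\{\mathrm{F}(S)\}$. *)

(* Defs.v *)
From HB Require Import structures.
From mathcomp Require Import all_boot all_order all_algebra.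
From mathcomp Require Import boolp classical_sets cardinality.

Set Implicit Arguments.
Unset Strict Implicit.
Unset Printing Implicit Defensive.

Local Open Scope classical_set_scope.

Definition ray (k : nat) : set nat := [set m | k <= m].
Definition ray0 (k : nat) : set nat := 0 |` ray k.

Definition numerical_semigroup (S : set nat) : Prop :=
  [/\ S 0, forall x y, S x -> S y -> S (x + y) & finite_set (~` S)].

Definition maxima (A : set int) : set int := A `&` ubound A.

(* The maximum is taken over the integers outside S, so that it is -1 for
   S = setT.  When S is a numerical semigroup it exists and is unique; the
   default value 0 is used only for sets that are not cofinite. *)
Definition frobenius (S : set nat) : int := xget 0%R (maxima (~` (Posz @` S))).

Definition nonzero (S : set nat) : set nat := S `\ 0.

Definition msg (S : set nat) : set nat :=
  nonzero S `\` [set x + y | x in nonzero S & y in nonzero S].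

Definition affine n (a b : n.-tuple nat) (s : nat) : n.-tuple nat :=
  [tuple tnth a i * s + tnth b i | i < n].

Definition cartesian_power n (S : set nat) : set (n.-tuple nat) :=
  [set t | forall i, S (tnth t i)].

Definition NS n (a b : n.-tuple nat) (X : set nat) : set (set nat) :=
  [set S | [/\ numerical_semigroup S, X `<=` S
             & forall s, nonzero S s -> cartesian_power S (affine a b s)]].

Definition NSr n (r : nat) (a b : n.-tuple nat) (X : set nat) :
    set (set nat) :=
  [set S | NS a b X S /\ S `<=` ray0 r.+1].

Record digraph (T : Type) := Digraph {
  vertices : set T;
  edges : set (T * T) }.

Definition is_graph (T : Type) (G : digraph T) : Prop :=
  vertices G !=set0 /\
  edges G `<=` [set e | [/\ vertices G e.1, vertices G e.2 & e.1 <> e.2]].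

(* [p] lists the vertices v_1, ..., v_k that follow v_0 = x, so that
   [pairmap pair x p] is the sequence of edges (v_0, v_1), ...,
   (v_(k-1), v_k), which determines p.  Distinctness is required of the
   edges only, and an edge is only traversed from its first to its second
   component. *)
Definition connecting_path (T : eqType) (G : digraph T) (x y : T)
    (p : seq T) : Prop :=
  [/\ path (fun v w => (v, w) \in edges G) x p,
      uniq (pairmap pair x p) & last x p = y].

Definition tree_with_root (T : eqType) (G : digraph T) (rho : T) : Prop :=
  [/\ is_graph G, vertices G rho
    & forall x, vertices G x -> x <> rho ->
        exists! p, connecting_path G x rho p].

Definition children (T : Type) (G : digraph T) (y : T) : set T :=
  [set x | edges G (x, y)].

(* The equation S' = S U {F(S)} is between sets of integers: F(S) may be -1,
   and then no S' satisfies it. *)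
Definition NSr_graph n (r : nat) (a b : n.-tuple nat) (X : set nat) :
    digraph (set nat) :=
  Digraph (NSr r a b X)
    [set e | [/\ NSr r a b X e.1, NSr r a b X e.2
               & Posz @` e.2 = (Posz @` e.1) `|` [set frobenius e.1]]].

(* Main.v *)
(** Passing from [S] to its parent [S U {F(S)}] strictly decreases the Frobenius
    number, so no edge is repeated along a path and iteration stops.  Every
    vertex has at most one parent, and only [{0, r+1, ->}] has none: any other
    vertex misses an integer above [r], hence has [F(S) > r], and adding [F(S)]
    preserves the affine condition because [a_i F(S) + b_i > F(S)].  A functional
    graph has exactly one path from a vertex to a sink that it can reach. *)
Require Import Defs.
From HB Require Import structures.
From mathcomp Require Import all_boot all_order all_algebra.
From mathcomp Require Import boolp classical_sets cardinality.
From mathcomp Require Import zify.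

Set Implicit Arguments.
Unset Strict Implicit.

Local Open Scope classical_set_scope.

(** The Frobenius number as a natural number; every cofinite set except [setT], whose value is -1,
    has one. *)
Definition largest_gap (S : set nat) (m : nat) : Prop :=
  ~ S m /\ forall k, m < k -> S k.

Lemma frobenius_eq (S : set nat) (z : int) :
  maxima (~` (Posz @` S)) z -> frobenius S = z.
Proof.
move=> [Az ubz]; rewrite /frobenius; case: xgetP => [y _ [Ay uby]|/(_ z)].
  by apply/eqP; rewrite Order.POrderTheory.eq_le ubz // uby.
by case; split.
Qed.

Lemma frobenius_nat (S : set nat) (m : nat) :
  largest_gap S m -> frobenius S = Posz m.
Proof.
move=> [nSm Sm]; apply: frobenius_eq; split; first by case=> k Sk [] km; rewrite -km in nSm.
move=> [k|k] nSk; last by lia.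
suff: ~~ (m < k) by lia.
by apply/negP => /Sm Sk; apply: nSk; exists k.
Qed.

Lemma frobenius_setT : frobenius setT = Negz 0.
Proof.
apply: frobenius_eq; split; first by case.
by move=> [k|k] nSk; [case: nSk; exists k | lia].
Qed.

Lemma largest_gap_exists (S : set nat) (m : nat) :
  finite_set (~` S) -> ~ S m -> exists k, largest_gap S k /\ m <= k.
Proof.
move=> /finite_seqP[s Ss] nSm.
have bnd k : `[< ~ S k >] -> k <= \max_(i <- s) i.
  move=> /asboolP nSk; apply: (@leq_bigmax_seq _ s xpredT id) => //.
  by have : (~` S) k by []; rewrite Ss.
have ex : exists k, `[< ~ S k >] by exists m; apply/asboolP.
case: (ex_maxnP ex bnd) => k /asboolP nSk maxk; exists k; split; last first.
  by apply: maxk; apply/asboolP.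
split=> // l kl; apply: contrapT => /asboolP/maxk; lia.
Qed.

Lemma frobenius_lt (S : set nat) (m k : nat) : finite_set (~` S) ->
  (frobenius S < Posz m)%R -> m <= k -> S k.
Proof.
move=> finS Fm mk; apply: contrapT => /(largest_gap_exists finS)[l [gl kl]].
by move: Fm; rewrite (frobenius_nat gl); lia.
Qed.

Section Graph.
Variables (r n : nat) (a b : n.-tuple nat) (X : set nat).
Let G := NSr_graph r a b X.

(** Moves the edge relation from integers to naturals, where [m] plays the role of F(S). *)
Lemma NSr_graph_edgeP (S S' : set nat) : edges G (S, S') <->
  [/\ NSr r a b X S, NSr r a b X S'
    & exists m, largest_gap S m /\ S' = m |` S].
Proof.
split=> -[/= VS VS'].
  have [[_ _ finS] _ _] := VS.1 => eqS'.
  split=> //.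
  have [ST|/existsNP[m0 nS]] := pselect (forall k, S k).
    (* If [S] is all of N, then F(S) = -1 would have to lie in the image of [S'], which has no
       negative element. *)
    have : (Posz @` S' ) (Negz 0).
      rewrite eqS'; right; rewrite -frobenius_setT /=.
      by congr frobenius; apply/esym/seteqP; split.
    by case.
  have [m [gm _]] := largest_gap_exists finS nS.
  exists m; split=> //; move: eqS'; rewrite (frobenius_nat gm) => eqS'.
  apply/seteqP; split=> k.
    move=> S'k; have : (Posz @` S') (Posz k) by exists k.
    by rewrite eqS' => -[[l Sl [<-]]|[->]]; [right|left].
  move=> k_in; have : (Posz @` S') (Posz k).
    by rewrite eqS'; case: k_in => [->|Sk]; [right|left; exists k].
  by case=> l Sl [<-].
move=> [m [gm eS']]; split=> //=.
by rewrite eS' (frobenius_nat gm) image_setU image_set1 setUC.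
Qed.

(** A gap of [S'] is a gap of [S] other than [m], hence below [m]; if no gap is left, the value
    drops to -1. *)
Lemma edge_frobenius_lt (S S' : set nat) :
  edges G (S, S') -> (frobenius S' < frobenius S)%R.
Proof.
move=> /NSr_graph_edgeP[_ [[[_ _ finS'] _ _] _] [m [gm eS']]].
rewrite (frobenius_nat gm).
have [S'T|/existsNP[k0 nS']] := pselect (forall k, S' k).
  suff -> : S' = setT by rewrite frobenius_setT.
  by apply/seteqP; split.
have [k [gk _]] := largest_gap_exists finS' nS'.
rewrite (frobenius_nat gk); case: gk => nS'k _.
have nSk : ~ S k by move=> Sk; apply: nS'k; rewrite eS'; right.
have km : k <> m by move=> km; apply: nS'k; rewrite eS'; left.
have : ~~ (m < k) by apply/negP => /gm.2.
lia.
Qed.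

Lemma edge_functional (S S1 S2 : set nat) :
  edges G (S, S1) -> edges G (S, S2) -> S1 = S2.
Proof.
move=> /NSr_graph_edgeP[_ _ [m [gm ->]]] /NSr_graph_edgeP[_ _ [k [gk ->]]].
by have [->] : Posz m = Posz k by rewrite -(frobenius_nat gm) (frobenius_nat gk).
Qed.

(** The added gap would have to lie in [ray0 r.+1], which contains every vertex. *)
Lemma root_sink (S : set nat) : ~ edges G (ray0 r.+1, S).
Proof.
move=> /NSr_graph_edgeP[_ [_ subS] [m [[nm _] eS]]].
by apply/nm/subS; rewrite eS; left.
Qed.

Lemma path_uniq_edges (S : set nat) (p : seq (set nat)) :
  path (fun v w => (v, w) \in edges G) S p -> uniq (pairmap pair S p).
Proof.
move=> Sp.
have : path (fun v w => (frobenius w < frobenius v)%R) S p.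
  by apply: sub_path Sp => v w /set_mem; exact: edge_frobenius_lt.
move=> Fp; have : uniq (S :: p).
  apply: (@sorted_uniq _ (fun v w => (frobenius w < frobenius v)%R) _ _ (S :: p)) => //.
  by move=> v u w vu wv; exact: Order.POrderTheory.lt_trans wv vu.
(* The vertices other than the last are the sources of the edges, so the edges already differ in
   their first components. *)
rewrite lastI rcons_uniq => /andP[_ ub].
apply: (@map_uniq _ _ fst).
suff -> : map fst (pairmap pair S p) = belast S p by [].
by elim: p S {Sp Fp ub} => //= v p IH S; rewrite IH.
Qed.

(** Both paths make the same forced step at each vertex, and neither can continue beyond the
    root. *)
Lemma path_to_root_unique (S : set nat) (p q : seq (set nat)) :
  connecting_path G S (ray0 r.+1) p -> connecting_path G S (ray0 r.+1) q ->
  p = q.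
Proof.
move=> [+ _ +] [+ _ +].
elim: p S q => [|v p IH] S [|w q] //=.
- by move=> _ -> /andP[/set_mem/root_sink].
- by move=> /andP[/set_mem + _] _ _ SR; rewrite SR => /root_sink.
move=> /andP[/set_mem Sv vp] lp /andP[/set_mem Sw wq] lq.
have vw := edge_functional Sv Sw; subst w.
by rewrite (IH v q).
Qed.

Hypothesis a_gt0 : forall i, 0 < tnth a i.
Hypothesis b_gt0 : forall i, 0 < tnth b i.

Lemma affine_gt (s : nat) (i : 'I_n) : s < tnth (affine a b s) i.
Proof. by rewrite tnth_mktuple; have := a_gt0 i; have := b_gt0 i; nia. Qed.

Lemma parent_exists (S : set nat) : NSr r a b X S -> S <> ray0 r.+1 ->
  exists m, largest_gap S m /\ edges G (S, m |` S).
Proof.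
move=> VS SR; have [[[S0 SD finS] XS affS] subS] := VS.
have [k [nSk rk]] : exists k, ~ S k /\ r < k.
  apply: contrapT => nex; apply: SR; apply/seteqP; split=> // k [->//|rk].
  by apply: contrapT => nSk; apply: nex; exists k.
have [m [gm km]] := largest_gap_exists finS nSk; have [nSm Sm] := gm.
exists m; split=> //; apply/NSr_graph_edgeP; split=> //; last by exists m.
split; first split.
- split; first by right.
    (* A sum involving [m] either exceeds [m], and so lies in [S], or has 0 as its other term. *)
    move=> x y [->|Sx] [->|Sy].
    + by right; apply: Sm; lia.
    + by case: y Sy => [|y] _; [left; rewrite /= addn0 | right; apply: Sm; lia].
    + by case: x Sx => [|x] _; [left | right; apply: Sm; lia].
    + by right; exact: SD.
  by apply: sub_finite_set finS => x nx Sx; apply: nx; right.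
- by move=> x /XS; right.
- move=> s [[->|Ss] s0] i; right; first exact/Sm/affine_gt.
  exact: affS.
move=> x [->|/subS//]; right; rewrite /ray /=; lia.
Qed.

Lemma path_to_root_exists (S : set nat) : NSr r a b X S ->
  exists p, connecting_path G S (ray0 r.+1) p.
Proof.
suff H N : (frobenius S < Posz N)%R -> NSr r a b X S ->
    exists p, path (fun v w => (v, w) \in edges G) S p /\ last S p = ray0 r.+1.
  (* A natural bound on F(S), valid also for F(S) = -1, on which to run the induction. *)
  have lt : (frobenius S < Posz `|frobenius S|.+1)%R by lia.
  move=> /(H _ lt)[p [Sp lp]]; exists p; split=> //; exact: path_uniq_edges.
elim: N S => [|N IH] S FS VS;
  (have [SR|/(parent_exists VS)[m [gm e]]] := pselect (S = ray0 r.+1);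
    first by exists [::]).
  (* For bound 0 only the root remains: any other vertex has a largest gap, so F(S) is not
     negative. *)
  by move: FS; rewrite (frobenius_nat gm).
have Fm := edge_frobenius_lt e; have [_ VmS _] := (NSr_graph_edgeP _ _).1 e.
have [|p [mp lp]] := IH (m |` S) _ VmS; first by lia.
by exists ((m |` S) :: p); split=> //=; rewrite mp andbT; apply/mem_set.
Qed.

Lemma root_vertex : X `<=` ray r.+1 -> NSr r a b X (ray0 r.+1).
Proof.
move=> hX; split=> //; split.
- split; first by left.
    move=> x y [->|rx] [->|ry]; [by left|by right|by right; rewrite addn0|right].
    by move: rx ry; rewrite /ray /=; lia.
  apply: (sub_finite_set _ (finite_II r.+1)) => x nx /=.
  by rewrite ltnNge; apply/negP => rx; apply: nx; right.
- by move=> x /hX; right.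
- move=> s [[->|rs] s0] i; first by case: s0.
  by right; have := affine_gt s i; move: rs; rewrite /ray /=; lia.
Qed.

Lemma NSr_graph_children (S : set nat) : NSr r a b X S ->
  children G S =
  [set S `\ m | m in [set m | [/\ msg S m, (frobenius S < Posz m)%R
                                & NS a b X (S `\ m)]]].
Proof.
move=> VS; have [[[S0 SD finS] XS affS] subS] := VS.
apply/seteqP; split=> [T e|T [m [[[Sm m0] irr] Fm Tm] <-]].
  have FT := edge_frobenius_lt e.
  have [VT _ [m [gm eS]]] := (NSr_graph_edgeP _ _).1 e.
  have [[[T0 TD _] _ _] _] := VT; have [nTm _] := gm.
  have TE : S `\ m = T.
    rewrite eS; apply/seteqP; split=> k; first by case=> -[].
    by move=> Tk; split; [right | move=> km; rewrite -km in nTm].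
  exists m => //; split; last by rewrite TE; exact: VT.1.
    split; first by split; [rewrite eS; left | move=> m0; apply: nTm; rewrite m0].
    (* Nonzero terms of a sum equal to [m] both differ from [m], so they lie in [T], and closure of
       [T] would put [m] in it. *)
    move=> [x [Sx x0] [y [Sy y0]] xym]; apply: nTm; rewrite -xym.
    by apply: TD; rewrite -TE; split=> //=; move: x0 y0 => /=; lia.
  by rewrite -(frobenius_nat gm).
apply/NSr_graph_edgeP; split=> //; first by split=> // k [/subS].
exists m; split; last first.
  apply/seteqP; split=> k; last by case=> [->|[]].
  by move=> Sk; have [->|km] := pselect (k = m); [left|right].
(* Since [m] exceeds F(S), everything above [m] is in [S], so deleting [m] makes it the largest
   gap. *)
split; first by case=> _ /(_ erefl).
move=> k mk; split; first by apply: (frobenius_lt finS Fm); lia.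
by move=> /= km; lia.
Qed.

End Graph.

Unset Implicit Arguments.
Set Strict Implicit.

Theorem proposition4p11 (r n : nat) (a b : n.-tuple nat) (X : set nat)
    (hn : 1 <= n)
    (ha : forall i : 'I_n, 0 < tnth a i)
    (hb : forall i : 'I_n, 0 < tnth b i)
    (hX0 : X !=set0)
    (hX : X `<=` ray r.+1) :
  tree_with_root (NSr_graph r a b X) (ray0 r.+1) /\
  (forall S : set nat, vertices (NSr_graph r a b X) S ->
     children (NSr_graph r a b X) S =
     [set S `\ m | m in [set m | [/\ msg S m, (frobenius S < Posz m)%R
                                   & NS a b X (S `\ m)]]]).
Proof.
have VR := root_vertex ha hb hX.
split; last exact: NSr_graph_children.
split=> //.
  split; first by exists (ray0 r.+1).
  move=> [S S'] e; have [VS VS' _] := e; split=> //= SS'.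
  have := edge_frobenius_lt e.
  by rewrite SS' Order.POrderTheory.ltxx.
move=> S VS _; have [p cp] := path_to_root_exists ha hb VS.
exists p; split=> // q; exact: path_to_root_unique cp.
Qed.
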